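(* Let $0<\rho<\sigma<1$ and let $x^0\in\mathbb{R}^n$. Let $G_1,\dots,G_m:\mathbb{R}^n\to\mathcal{I}(\mathbb{R})$ be $gH$-continuously differentiable interval-valued maps and let $L_0=\{x\in\mathbb{R}^n: G_i(x)\preceq G_i(x^0)\text{ for all }i=1,\dots,m\}$. Assume: (1) for each $i=1,\dots,m$, $\nabla_{gH}G_i$ is $gH$-Lipschitz continuous on $L_0$ with some constant $L_i$; (2) for every sequence $(y^k)$ in $L_0$ with $G_i(y^{k+1})\preceq G_i(y^k)$ for all $k$ and all $i=1,\dots,m$, there exist $\mathcal{G}_1,\dots,\mathcal{G}_m\in\mathcal{I}(\mathbb{R})$ such that $\mathcal{G}_i\preceq G_i(y^k)$ for all $k$ and all $i$. Consider an iteration $x^{k+1}=x^k+t_kd^k$, $k\ge0$, where for every $k$ the vector $d^k\in\mathbb{R}^n$ is a descent direction for all $G_i$ at $x^k$, i.e. $\psi\circ\phi_{x^k}(d^k)<0$, and $t_k>0$ satisfies the standard Wolfe conditions $$G_i(x^k+t_kd^k)\preceq G_i(x^k)\oplus[\rho t_k,\rho t_k]\odot\psi\circ\phi_{x^k}(d^k)\ \ (i=1,\dots,m),\qquad \psi\circ\phi_{x^k+t_kd^k}(d^k)\ge\sigma\,\psi\circ\phi_{x^k}(d^k).$$ Then $$\sum_{k\ge0}\frac{[\psi\circ\phi_{x^k}(d^k)]^2}{\|d^k\|^2}<+\infty.$$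
   Context: $\|\cdot\|$ is the Euclidean norm. $\mathcal{I}(\mathbb{R})$ is the set of closed bounded intervals of $\mathbb{R}$. For $A=[a_1,a_2]$, $B=[b_1,b_2]$ in $\mathcal{I}(\mathbb{R})$ and $\alpha\in\mathbb{R}$: $A\oplus B=[a_1+b_1,a_2+b_2]$; $\alpha\odot A=A\odot\alpha=[\min\{\alpha a_1,\alpha a_2\},\max\{\alpha a_1,\alpha a_2\}]$; $A\preceq B$ means $a_1\le b_1$ and $a_2\le b_2$. Write $G_i=[\underline{G}_i,\overline{G}_i]$ with real-valued endpoint functions $\underline{G}_i\le\overline{G}_i$. ''$gH$-continuously differentiable'' means that the endpoint functions are differentiable and the $gH$-gradient $\nabla_{gH}G_i(x)$ is continuous in $x$, where $\nabla_{gH}G_i(x)$ is the vector of intervals whose $j$-th component is $[\underline{\nabla_{gH}G_i}(x)_j,\overline{\nabla_{gH}G_i}(x)_j]$ with $$\underline{\nabla_{gH}G_i}(x)_j=\min\{\partial_j\underline{G}_i(x),\partial_j\overline{G}_i(x)\},\qquad \overline{\nabla_{gH}G_i}(x)_j=\max\{\partial_j\underline{G}_i(x),\partial_j\overline{G}_i(x)\};$$ continuity means that the maps $\underline{\nabla_{gH}G_i},\overline{\nabla_{gH}G_i}:\mathbb{R}^n\to\mathbb{R}^n$ are continuous, and $gH$-Lipschitz continuity of $\nabla_{gH}G_i$ on $L_0$ with constant $L_i$ means that both of these maps are Lipschitz on $L_0$ with constant $L_i$ (Euclidean norm). For $x,v\in\mathbb{R}^n$, with $|v|=(|v_1|,\dots,|v_n|)^\top$,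 $$\psi\circ\phi_x(v):=\max_{1\le i\le m}\Big[\tfrac12\big(\underline{\nabla_{gH}G_i}(x)+\overline{\nabla_{gH}G_i}(x)\big)^\top v+\tfrac12\big(\overline{\nabla_{gH}G_i}(x)-\underline{\nabla_{gH}G_i}(x)\big)^\top|v|\Big].$$ *)

(* Defs.v *)
From HB Require Import structures.
From mathcomp Require Import all_boot all_order all_algebra.
From mathcomp Require Import all_classical all_reals all_analysis.

Set Implicit Arguments.
Unset Strict Implicit.
Unset Printing Implicit Defensive.

Import Order.TTheory GRing.Theory Num.Theory numFieldNormedType.Exports.
Local Open Scope classical_set_scope.
Local Open Scope ring_scope.

Record cbitv (R : realType) := CBItv {
  itv_lo : R;
  itv_hi : R;
  itv_le : itv_lo <= itv_hi }.

Definition itv_single (R : realType) (a : R) : cbitv R := CBItv (lexx a).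

Definition itv_add (R : realType) (A B : cbitv R) : cbitv R :=
  CBItv (lerD (itv_le A) (itv_le B)).

Lemma min_le_max_subproof (R : realType) (a b : R) : Num.min a b <= Num.max a b.
Proof. by rewrite ge_min !le_max lexx. Qed.

Definition itv_scale (R : realType) (a : R) (A : cbitv R) : cbitv R :=
  CBItv (min_le_max_subproof (a * itv_lo A) (a * itv_hi A)).

Definition itv_preceq (R : realType) (A B : cbitv R) : Prop :=
  itv_lo A <= itv_lo B /\ itv_hi A <= itv_hi B.

(* The library norm on row vectors is the sup norm. *)
Definition enorm (R : realType) (n : nat) (v : 'rV[R]_n) : R :=
  Num.sqrt (\sum_(j < n) v 0 j ^+ 2).

Definition dotrv (R : realType) (n : nat) (u v : 'rV[R]_n) : R :=
  \sum_(j < n) u 0 j * v 0 j.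

Section GH.
Context (R : realType) (n : nat).
Implicit Types (F : 'rV[R]_n -> cbitv R) (x v : 'rV[R]_n).

Definition lower_fun F x : R := itv_lo (F x).
Definition upper_fun F x : R := itv_hi (F x).

Definition partial (f : 'rV[R]_n -> R) (j : 'I_n) x : R :=
  'D_(delta_mx 0 j) f x.

Definition gH_gradient F x : 'I_n -> cbitv R := fun j =>
  CBItv (min_le_max_subproof (partial (lower_fun F) j x)
                             (partial (upper_fun F) j x)).

Definition gH_gradient_lo F x : 'rV[R]_n := \row_j itv_lo (gH_gradient F x j).
Definition gH_gradient_hi F x : 'rV[R]_n := \row_j itv_hi (gH_gradient F x j).

(* Continuity for the library (sup norm) topology of 'rV[R]_n, which is also
   the Euclidean one. *)
Definition gH_continuously_differentiable F : Prop :=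
  [/\ forall x, differentiable (lower_fun F) x,
      forall x, differentiable (upper_fun F) x,
      continuous (gH_gradient_lo F) &
      continuous (gH_gradient_hi F)].

Definition elipschitz_on (A : set 'rV[R]_n) (L : R)
    (f : 'rV[R]_n -> 'rV[R]_n) : Prop :=
  forall x y, A x -> A y -> enorm (f x - f y) <= L * enorm (x - y).

Definition gH_gradient_lipschitz_on (A : set 'rV[R]_n) (L : R) F : Prop :=
  elipschitz_on A L (gH_gradient_lo F) /\ elipschitz_on A L (gH_gradient_hi F).

Definition psi_phi_component F x v : R :=
  2^-1 * dotrv (gH_gradient_lo F x + gH_gradient_hi F x) v
  + 2^-1 * dotrv (gH_gradient_hi F x - gH_gradient_lo F x) (map_mx Num.norm v).

(* There are m.+1 >= 1 maps; the initial value of the iterated maximum is one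
   of its terms. *)
Definition psi_phi (m : nat) (G : 'I_m.+1 -> 'rV[R]_n -> cbitv R) x v : R :=
  \big[Num.max/psi_phi_component (G ord0) x v]_(i < m.+1)
    psi_phi_component (G i) x v.

Definition level_set (m : nat) (G : 'I_m.+1 -> 'rV[R]_n -> cbitv R)
    (x0 : 'rV[R]_n) : set 'rV[R]_n :=
  [set x | forall i, itv_preceq (G i x) (G i x0)].

Definition descent_direction (m : nat) (G : 'I_m.+1 -> 'rV[R]_n -> cbitv R)
    x v : Prop :=
  psi_phi G x v < 0.

Definition standard_wolfe (m : nat) (G : 'I_m.+1 -> 'rV[R]_n -> cbitv R)
    (rho sigma : R) x v (t : R) : Prop :=
  (forall i, itv_preceq (G i (x + t *: v))
     (itv_add (G i x) (itv_scale (psi_phi G x v) (itv_single (rho * t))))) /\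
  sigma * psi_phi G x v <= psi_phi G (x + t *: v) v.

End GH.

(* Main.v *)
Require Import Defs.
From HB Require Import structures.
From mathcomp Require Import all_boot all_order all_algebra.
From mathcomp Require Import all_classical all_reals all_analysis.
From mathcomp Require Import ring lra.

Set Implicit Arguments.
Unset Strict Implicit.
Unset Printing Implicit Defensive.

Import Order.TTheory GRing.Theory Num.Theory numFieldNormedType.Exports.
Local Open Scope classical_set_scope.
Local Open Scope ring_scope.

(** The proof is the classical Zoutendijk argument.  Write [p_k < 0] for
    [psi_phi G (x k) (d k)].  The first Wolfe condition makes every [G i]
    decrease along the iteration, so all iterates stay in the level set; no
    point between two iterates is ever visited, so that set may be nonconvex.

    A maximum moves by at most as much as its terms, and by Cauchy-Schwarz each
    term [psi_phi_component (G i) _ v] moves by at most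
    [(|Delta lo| + |Delta hi|) |v|], where [Delta lo] and [Delta hi] are the
    increments of the two gradient maps.  Hence the Lipschitz hypothesis bounds
    the increment of [psi_phi G _ (d k)] along a step by
    [2 * M * t k * |d k| ^ 2], for a common Lipschitz constant [M]
    ([psi_phi_increment_le]).  The curvature condition says that this increment
    is at least [(1 - sigma) * - p_k], so the step length [t k] cannot be too
    small ([step_decrease_ge]):
    the decrease [rho * t k * - p_k] of each [G i] dominates a fixed
    multiple of [p_k ^ 2 / |d k| ^ 2].  Since the lower endpoint of a single
    [G i] is bounded below along the iteration, these decreases telescope to a
    finite total ([nneseries_telescope_lty]). *)

(** * Euclidean geometry of row vectors *)

Section Euclid.
Context (R : realType) (n : nat).
Implicit Types (u v w : 'rV[R]_n).

Lemma enorm_ge0 v : 0 <= enorm v.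
Proof. exact: sqrtr_ge0. Qed.

Lemma enorm_sqr v : enorm v ^+ 2 = \sum_(j < n) v 0 j ^+ 2.
Proof. by rewrite sqr_sqrtr// sumr_ge0// => j _; exact: sqr_ge0. Qed.

Lemma enormN v : enorm (- v) = enorm v.
Proof.
by congr Num.sqrt; apply: eq_bigr => j _; rewrite mxE sqrrN.
Qed.

Lemma enormZ (a : R) v : enorm (a *: v) = `|a| * enorm v.
Proof.
rewrite /enorm -sqrtr_sqr -sqrtrM ?sqr_ge0// mulr_sumr.
by congr Num.sqrt; apply: eq_bigr => j _; rewrite mxE exprMn.
Qed.

Lemma enorm_abs v : enorm (map_mx Num.norm v) = enorm v.
Proof.
by congr Num.sqrt; apply: eq_bigr => j _; rewrite mxE real_normK ?num_real.
Qed.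

Lemma enorm_eq0 v : enorm v = 0 -> v = 0.
Proof.
move=> v0; apply/rowP => j; rewrite mxE; apply/eqP; rewrite -sqrf_eq0.
have /eqP := enorm_sqr v; rewrite v0 expr0n/= eq_sym psumr_eq0; last first.
  by move=> i _; exact: sqr_ge0.
by move/allP/(_ j); rewrite mem_index_enum; exact.
Qed.

Lemma dotrvDl u w v : dotrv (u + w) v = dotrv u v + dotrv w v.
Proof.
by rewrite /dotrv -big_split; apply: eq_bigr => j _; rewrite mxE mulrDl.
Qed.

Lemma dotrvNl u v : dotrv (- u) v = - dotrv u v.
Proof.
by rewrite /dotrv -sumrN; apply: eq_bigr => j _; rewrite mxE mulNr.
Qed.

Lemma dotrv0l v : dotrv 0 v = 0.
Proof. by rewrite /dotrv big1// => j _; rewrite mxE mul0r. Qed.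

Lemma dotrv0r u : dotrv u 0 = 0.
Proof. by rewrite /dotrv big1// => j _; rewrite mxE mulr0. Qed.

(** Cauchy-Schwarz, from the nonnegativity of [| |v| u - |u| v | ^ 2], whose
    expansion is [2 |u| |v| (|u| |v| - u . v)]. *)
Lemma dotrv_le_enorm u v : dotrv u v <= enorm u * enorm v.
Proof.
have [/enorm_eq0->|u0] := eqVneq (enorm u) 0.
  by rewrite dotrv0l mulr_ge0// enorm_ge0.
have [/enorm_eq0->|v0] := eqVneq (enorm v) 0.
  by rewrite dotrv0r mulr_ge0// enorm_ge0.
have uv_gt0 : 0 < 2 * (enorm u * enorm v).
  by rewrite !mulr_gt0// lt_def enorm_ge0 ?u0 ?v0.
rewrite -subr_ge0 -(pmulr_rge0 _ uv_gt0).
suff -> : 2 * (enorm u * enorm v) * (enorm u * enorm v - dotrv u v) =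
    \sum_(j < n) (enorm v * u 0 j - enorm u * v 0 j) ^+ 2.
  by apply: sumr_ge0 => j _; exact: sqr_ge0.
transitivity (enorm v ^+ 2 * (\sum_(j < n) u 0 j ^+ 2)
    + enorm u ^+ 2 * (\sum_(j < n) v 0 j ^+ 2)
    - 2 * (enorm u * enorm v) * dotrv u v).
  by rewrite -!enorm_sqr; ring.
rewrite /dotrv !mulr_sumr -big_split/= -sumrB.
by apply: eq_bigr => j _; ring.
Qed.

End Euclid.

(** * Variation of the maximum of the directional bounds *)

Section Variation.
Context (R : realType) (n : nat).
Implicit Types (F : 'rV[R]_n -> cbitv R) (x y v : 'rV[R]_n).

(** The increment is half the sum of four inner products, of [Delta lo] and
    [Delta hi] with [v] and, up to sign, with [|v|]; since [v] and [|v|] have the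
    same length, Cauchy-Schwarz bounds both products of each gradient map by the
    same quantity. *)
Lemma psi_phi_component_increment_le F x y v :
  psi_phi_component F y v <= psi_phi_component F x v
    + (enorm (gH_gradient_lo F y - gH_gradient_lo F x)
       + enorm (gH_gradient_hi F y - gH_gradient_hi F x)) * enorm v.
Proof.
rewrite /psi_phi_component.
(* Only the four vectors matter; abstracting them keeps conversion from
   unfolding the derivatives. *)
move: (gH_gradient_lo F y) (gH_gradient_lo F x) => a b.
move: (gH_gradient_hi F y) (gH_gradient_hi F x) => c e.
have := dotrv_le_enorm (a - b) v; have := dotrv_le_enorm (c - e) v.
have := dotrv_le_enorm (- (a - b)) (map_mx Num.norm v).
have := dotrv_le_enorm (c - e) (map_mx Num.norm v).
rewrite enormN enorm_abs dotrvNl !dotrvDl !dotrvNl.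
by lra.
Qed.

Lemma psi_phi_le_add m (G : 'I_m.+1 -> 'rV[R]_n -> cbitv R) x y v (e : R) :
  (forall i, psi_phi_component (G i) y v <= psi_phi_component (G i) x v + e) ->
  psi_phi G y v <= psi_phi G x v + e.
Proof.
move=> le_e.
have le_psi i : psi_phi_component (G i) y v <= psi_phi G x v + e.
  apply: le_trans (le_e i) _; rewrite lerD2r.
  exact: (le_bigmax _ (fun i => psi_phi_component (G i) x v)).
by apply: bigmax_le.
Qed.

(** Only the two endpoints of the step need to lie in [A]: the Lipschitz bound
    compares the gradients at these two points and is never integrated along the
    segment joining them. *)
Lemma psi_phi_increment_le m (G : 'I_m.+1 -> 'rV[R]_n -> cbitv R)
    (A : set 'rV[R]_n) (M : R) x v (t : R) :
  (forall i, gH_gradient_lipschitz_on A M (G i)) ->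
  0 <= t -> A x -> A (x + t *: v) ->
  psi_phi G (x + t *: v) v <= psi_phi G x v + 2 * M * (t * enorm v ^+ 2).
Proof.
move=> lipG t0 Ax Ay; apply: psi_phi_le_add => i.
apply: le_trans (psi_phi_component_increment_le _ x _ _) _; rewrite lerD2l.
have [/(_ _ _ Ay Ax) lo /(_ _ _ Ay Ax) hi] := lipG i; move: lo hi.
move: (_ - gH_gradient_lo _ x) (_ - gH_gradient_hi _ x) => a b.
rewrite (addrC x) addrK enormZ (ger0_norm t0) => lo hi.
rewrite (_ : 2 * M * _ =
  (M * (t * enorm v) + M * (t * enorm v)) * enorm v); last by ring.
by rewrite ler_wpM2r ?enorm_ge0// lerD.
Qed.

(** The constants may be negative when [A] has at most one point, hence the
    absolute values; the summand [1] makes the result a valid denominator. *)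
Lemma common_lipschitz_constant (I : finType) (A : set 'rV[R]_n)
    (G : I -> 'rV[R]_n -> cbitv R) :
  (forall i, exists L, gH_gradient_lipschitz_on A L (G i)) ->
  exists2 M : R, 0 < M & forall i, gH_gradient_lipschitz_on A M (G i).
Proof.
move=> /choice[L LG]; exists (1 + \sum_i `|L i|).
  by rewrite ltr_pwDl// sumr_ge0.
move=> i; have leM : L i <= 1 + \sum_i `|L i|.
  rewrite (bigD1 i)//= addrCA (le_trans (ler_norm _))// lerDl.
  by rewrite addr_ge0// sumr_ge0.
have [lo hi] := LG i; split=> x y Ax Ay;
  [apply: le_trans (lo x y Ax Ay) _ | apply: le_trans (hi x y Ax Ay) _];
  by rewrite ler_wpM2r// enorm_ge0.
Qed.

End Variation.

(** * Decrease per step and summation *)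

(** The hypothesis is a lower bound [c * - p / (K * e ^+ 2)] on the step [t],
    and multiplying it by [- p > 0] gives the claim.  When [e = 0], the quotient
    on the left is [0] by the convention on inverses. *)
Lemma step_decrease_ge (R : realType) (c K p t e : R) :
  0 < K -> 0 <= t -> p < 0 -> c * - p <= K * (t * e ^+ 2) ->
  c / K * (p ^+ 2 / e ^+ 2) <= t * - p.
Proof.
move=> K0 t0 p0 curv; have [->|e0] := eqVneq e 0.
  by rewrite expr0n/= invr0 !mulr0 mulr_ge0// oppr_ge0 ltW.
have e2 : 0 < e ^+ 2 by rewrite exprn_even_gt0.
rewrite (_ : c / K * _ = (c * - p) * - p / (K * e ^+ 2)); last first.
  by field; rewrite e0 (gt_eqF K0).
rewrite ler_pdivrMr; last by rewrite mulr_gt0.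
rewrite (_ : t * - p * _ = K * (t * e ^+ 2) * - p); last by ring.
by rewrite ler_wpM2r// oppr_ge0 ltW.
Qed.

(** The differences [f k - f k.+1] telescope, so [c] times every partial sum of
    [a] is at most [f 0 - b]. *)
Lemma nneseries_telescope_lty (R : realType) (a f : nat -> R) (c b : R) :
  0 < c -> (forall k, 0 <= a k) ->
  (forall k, c * a k <= f k - f k.+1) -> (forall k, b <= f k) ->
  (\sum_(0 <= k <oo) (a k)%:E < +oo)%E.
Proof.
move=> c0 a0 caf bf.
apply: (@le_lt_trans _ _ (c^-1 * (f 0%N - b))%:E); last exact: ltry.
apply: lime_le; first by apply: is_cvg_nneseries => k _ _; rewrite lee_fin.
apply: nearW => N; rewrite sumEFin lee_fin mulrC ler_pdivlMr// mulrC mulr_sumr.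
apply: (@le_trans _ _ (\sum_(0 <= k < N) (f k - f k.+1))).
  by apply: ler_sum => k _; exact: caf.
rewrite (eq_bigr (fun k => - (f k.+1 - f k))); last first.
  by move=> k _; rewrite opprB.
by rewrite sumrN telescope_sumr// opprB lerD2l lerN2.
Qed.

Section WolfeDecrease.
Context (R : realType) (n m : nat) (G : 'I_m.+1 -> 'rV[R]_n -> cbitv R).
Context (rho sigma : R).
Implicit Types (x v : 'rV[R]_n).

Lemma standard_wolfe_lo x v t i : standard_wolfe G rho sigma x v t ->
  itv_lo (G i (x + t *: v)) <= itv_lo (G i x) + psi_phi G x v * (rho * t).
Proof. by case=> /(_ i)[+ _] _; rewrite /= minxx. Qed.

Lemma standard_wolfe_preceq x v t i : 0 <= rho -> 0 <= t ->
  descent_direction G x v -> standard_wolfe G rho sigma x v t ->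
  itv_preceq (G i (x + t *: v)) (G i x).
Proof.
move=> rho0 t0 desc [/(_ i)[+ +] _]; rewrite /= minxx maxxx => lo hi.
have le0 : psi_phi G x v * (rho * t) <= 0.
  by rewrite mulr_le0_ge0 ?mulr_ge0// ltW.
by split; [apply: le_trans lo _ | apply: le_trans hi _]; rewrite gerDl.
Qed.

End WolfeDecrease.

Theorem proposition4p1 (R : realType) (n m : nat) (rho sigma : R)
  (hrho : 0 < rho) (hrs : rho < sigma) (hsigma : sigma < 1)
  (x0 : 'rV[R]_n) (G : 'I_m.+1 -> 'rV[R]_n -> cbitv R)
  (hG : forall i, gH_continuously_differentiable (G i))
  (hLip : forall i, exists L : R,
     gH_gradient_lipschitz_on (level_set G x0) L (G i))
  (hbnd : forall y : nat -> 'rV[R]_n,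
     (forall k, level_set G x0 (y k)) ->
     (forall k i, itv_preceq (G i (y k.+1)) (G i (y k))) ->
     exists B : 'I_m.+1 -> cbitv R, forall k i, itv_preceq (B i) (G i (y k)))
  (x d : nat -> 'rV[R]_n) (t : nat -> R)
  (hx0 : x 0%N = x0)
  (hx : forall k, x k.+1 = x k + t k *: d k)
  (hd : forall k, descent_direction G (x k) (d k))
  (ht : forall k, 0 < t k)
  (hwolfe : forall k, standard_wolfe G rho sigma (x k) (d k) (t k)) :
  (\sum_(0 <= k <oo)
     (psi_phi G (x k) (d k) ^+ 2 / enorm (d k) ^+ 2)%:E < +oo)%E.
Proof.
have rho_ge0 := ltW hrho.
have t_ge0 k : 0 <= t k by exact: ltW.
have decr k i : itv_preceq (G i (x k.+1)) (G i (x k)).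
  by rewrite hx; apply: standard_wolfe_preceq (hwolfe k) => //; exact: hd.
have level k : level_set G x0 (x k).
  elim: k => [|k IHk] i; first by rewrite hx0.
  have [lo hi] := decr k i; have [lo0 hi0] := IHk i.
  by split; [exact: le_trans lo lo0 | exact: le_trans hi hi0].
have [B leB] := hbnd x level decr.
have [M M_gt0 lipM] := common_lipschitz_constant hLip.
have K_gt0 : 0 < 2 * M by rewrite mulr_gt0.
(* The step bound times the factor [rho] of the sufficient decrease. *)
apply: (@nneseries_telescope_lty _ _ (fun k => itv_lo (G ord0 (x k)))
  (rho * ((1 - sigma) / (2 * M))) (itv_lo (B ord0))).
- by rewrite mulr_gt0// divr_gt0// subr_gt0.
- by move=> k; rewrite divr_ge0 ?sqr_ge0.
- move=> k; set p := psi_phi G (x k) (d k).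
  have curv : (1 - sigma) * - p <= 2 * M * (t k * enorm (d k) ^+ 2).
    have level1 : level_set G x0 (x k + t k *: d k) by rewrite -hx.
    have := psi_phi_increment_le lipM (t_ge0 k) (level k) level1.
    by have [_] := hwolfe k; rewrite -/p; lra.
  have := step_decrease_ge K_gt0 (t_ge0 k) (hd k : p < 0) curv.
  rewrite -(ler_pM2l hrho) => quot_le.
  rewrite -mulrA; apply: le_trans quot_le _.
  by have := standard_wolfe_lo ord0 (hwolfe k); rewrite -hx -/p; lra.
- by move=> k; have [] := leB k ord0.
Qed.
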